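(* $\sim_{hhpb}\subsetneq\sim_{\mathrm{TFL}}$: for all systems $\mathfrak T_1,\mathfrak T_2$, if $\mathfrak T_1\sim_{hhpb}\mathfrak T_2$ then $\mathfrak T_1\sim_{\mathrm{TFL}}\mathfrak T_2$, and there exist systems that are $\mathrm{TFL}$-equivalent but not hereditary history-preserving bisimilar.
   Context: A system (TSI) is $\mathfrak T=(S,s_0,T,I,\Sigma)$ with states $S$, initial $s_0$, labels $\Sigma$, transitions $T\subseteq S\times\Sigma\times S$, irreflexive symmetric independence $I\subseteq T\times T$ satisfying: with $(s,a,s_1)\prec(s_2,a,q)$ iff $\exists b$: $(s,a,s_1)I(s,b,s_2)$, $(s,a,s_1)I(s_1,b,q)$, $(s,b,s_2)I(s_2,a,q)$ and $\sim$ its equivalence closure, (A1) $(s,a,s_1)\sim(s,a,s_2)\Rightarrow s_1=s_2$; (A2) $(s,a,s_1)I(s,b,s_2)\Rightarrow\exists q.\,(s,a,s_1)I(s_1,b,q)\wedge(s,b,s_2)I(s_2,a,q)$; (A3) $(s,a,s_1)I(s_1,b,q)\Rightarrow\exists s_2.\,(s,a,s_1)I(s,b,s_2)\wedge(s,b,s_2)I(s_2,a,q)$; (A4) $t\sim t'\Rightarrow\{u:tIu\}=\{u:t'Iu\}$; systems are image-finite. For $t=(s,a,s')$: $\sigma(t)=s,\tau(t)=s',\delta(t)=a$. Relations: $t\otimes t'$ iff $\sigma(t)=\sigma(t')\wedge tIt'$; $t\ominus t'$ iff $\tau(t)=\sigma(t')\wedge tIt'$; $t\le t'$ iff $\tau(t)=\sigma(t')\wedge\neg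 tIt'$. Processes: $\mathfrak X(s)$ = transitions with source $s$; conflict-free set = set with common source, pairwise $\otimes$; support sets = the $\mathfrak X(s)$ and non-empty conflict-free sets; $M\sqsubseteq R$ iff $M\subseteq R$ and no $t\in R\setminus M$ has $t\otimes t'$ for all $t'\in M$; $\mathcal X$ = all $\mathfrak X(s)$ and all support sets $M\sqsubseteq\mathfrak X(s)$; $\mathfrak A=T\cup\{t_\epsilon\}$ with fresh $t_\epsilon$, $\tau(t_\epsilon)=s_0$, $t_\epsilon\le t$ whenever $\sigma(t)=s_0$, never $t_\epsilon\ominus t$; $\mathfrak S=\mathcal X\times\mathfrak A$, initial process $(\mathfrak X(s_0),t_\epsilon)$. $\mathfrak T_1\sim_{\mathrm{TFL}}\mathfrak T_2$ iff the initial processes satisfy the same closed fixpoint-free formulas $\phi::=\mathrm{tt}\mid\neg\phi\mid\phi\wedge\phi\mid\langle a\rangle_c\phi\mid\langle a\rangle_{nc}\phi\mid\langle\otimes\rangle\phi$, where $[\![\langle a\rangle_c\phi]\!]=\{(R,t):\exists r\in R.\ \delta(r)=a,\ t\le r,\ (\mathfrak X(\tau(r)),r)\in[\![\phi]\!]\}$, $\langle a\rangle_{nc}$ likewise with $t\ominus r$, $[\![\langle\otimes\rangle\phi]\!]=\{(R,t):\exists M\in\mathcal X.\ M\sqsubseteq R,\ (M,t)\in[\![\phi]\!]\}$, booleans as usual in $\mathfrak S$. $\sim_{hhpb}$: runs are finite sequences $[t_1,\dots,t_k]$ with $\sigma(t_1)=s_0$, $\sigma(t_{i+1})=\tau(t_i)$;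 $\epsilon$ empty run, $\varrho(\pi)$ last transition, $\pi(i)$ the $i$-th transition. Labelled poset of a run: elements $1..k$ labelled $\delta(t_i)$, order the reflexive-transitive closure of $\{(i,j):i<j,\neg t_iIt_j\}$. $(\pi_1.u,\pi_2.v)$ synchronous iff $(\varrho(\pi_1),u)\in I_1\Leftrightarrow(\varrho(\pi_2),v)\in I_2$ and the labelled posets are isomorphic. $\pi(i)$ is backwards enabled iff $\pi(i)I\pi(j)$ for all $j>i$; $\pi-\pi(i)$ removes the $i$-th element. hhpb game from $(\epsilon,\epsilon)$: each round Adam either picks a system and a transition $u$ from the end state of the current run there and Eve answers with an equally labelled transition $v$ from the end state of the run in the other system keeping the extended pair synchronous; or Adam picks a system and an index $i$ with $\pi(i)$ backwards enabled there and Eve must delete the $i$-th transition of the other run, which must also be backwards enabled, with the resulting runs inducing isomorphic labelled posets. A player unable to move loses; infinite plays are won by Eve. $\mathfrak T_1\sim_{hhpb}\mathfrak T_2$ iff Eve has a winning strategy. *)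

(* Defs.v *)
From Stdlib Require Import List Relations Arith.
Import ListNotations.

Set Implicit Arguments.

Record TSI (L : Type) := mkTSI {
  St : Type;
  s0 : St;
  tr : St -> L -> St -> Prop;
  ind : (St * L * St) -> (St * L * St) -> Prop
}.

Arguments St {L}.
Arguments s0 {L}.
Arguments tr {L}.
Arguments ind {L}.

Section Sys.
Variable L : Type.
Variable X : TSI L.

Definition trans := (St X * L * St X)%type.
Definition src (t : trans) : St X := fst (fst t).
Definition lab (t : trans) : L := snd (fst t).
Definition tgt (t : trans) : St X := snd t.
Definition inT (t : trans) : Prop := tr X (src t) (lab t) (tgt t).
Definition I (t u : trans) : Prop := ind X t u.

Definition prec (t u : trans) : Prop :=
  lab u = lab t /\
  exists b : L,
    I t (src t, b, src u) /\ I t (tgt t, b, tgt u) /\ I (src t, b, src u) u.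

Definition simT : trans -> trans -> Prop := clos_refl_sym_trans trans prec.

Definition is_TSI : Prop :=
  (forall t u, I t u -> inT t /\ inT u) /\
  (forall t, ~ I t t) /\
  (forall t u, I t u -> I u t) /\
  (forall s a s1 s2, simT (s, a, s1) (s, a, s2) -> s1 = s2) /\
  (forall s a b s1 s2, I (s, a, s1) (s, b, s2) ->
     exists q, I (s, a, s1) (s1, b, q) /\ I (s, b, s2) (s2, a, q)) /\
  (forall s a b s1 q, I (s, a, s1) (s1, b, q) ->
     exists s2, I (s, a, s1) (s, b, s2) /\ I (s, b, s2) (s2, a, q)) /\
  (forall t t', simT t t' -> forall u, I t u <-> I t' u) /\
  (forall s a, exists l : list (St X), forall s', tr X s a s' -> In s' l).

Definition tset := trans -> Prop.

Definition seteq (M N : tset) : Prop := forall t, M t <-> N t.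

Definition Xs (s : St X) : tset := fun t => inT t /\ src t = s.

Definition otimes (t u : trans) : Prop := src t = src u /\ I t u.
Definition ominus (t u : trans) : Prop := tgt t = src u /\ I t u.
Definition leT (t u : trans) : Prop := tgt t = src u /\ ~ I t u.

Definition conflict_free (M : tset) : Prop :=
  (forall t, M t -> inT t) /\
  (exists s, forall t, M t -> src t = s) /\
  (forall t u, M t -> M u -> t <> u -> otimes t u).

Definition support_set (M : tset) : Prop :=
  (exists s, seteq M (Xs s)) \/ ((exists t, M t) /\ conflict_free M).

Definition sqsub (M R : tset) : Prop :=
  (forall t, M t -> R t) /\
  ~ (exists t, R t /\ ~ M t /\ forall t', M t' -> otimes t t').

Definition inCalX (M : tset) : Prop :=
  (exists s, seteq M (Xs s)) \/
  (support_set M /\ exists s, sqsub M (Xs s)).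

(* the set A = T + {t_eps}; None stands for t_eps *)
Definition leA (t : option trans) (r : trans) : Prop :=
  match t with
  | None => src r = s0 X
  | Some t => leT t r
  end.

Definition ominusA (t : option trans) (r : trans) : Prop :=
  match t with
  | None => False
  | Some t => ominus t r
  end.

End Sys.

Inductive form (L : Type) : Type :=
  | ftt : form L
  | fneg : form L -> form L
  | fand : form L -> form L -> form L
  | fdiam_c : L -> form L -> form L
  | fdiam_nc : L -> form L -> form L
  | fdiam_ot : form L -> form L.

Arguments ftt {L}.

Fixpoint sat (L : Type) (X : TSI L) (R : tset X) (t : option (trans X))
         (phi : form L) {struct phi} : Prop :=
  match phi with
  | ftt => True
  | fneg p => ~ @sat L X R t p
  | fand p q => @sat L X R t p /\ @sat L X R t q
  | fdiam_c a p =>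
      exists r, R r /\ lab r = a /\ leA t r /\ @sat L X (Xs (tgt r)) (Some r) p
  | fdiam_nc a p =>
      exists r, R r /\ lab r = a /\ ominusA t r /\ @sat L X (Xs (tgt r)) (Some r) p
  | fdiam_ot p =>
      exists M, inCalX M /\ sqsub M R /\ @sat L X M t p
  end.

Definition TFL_eq (L : Type) (X1 X2 : TSI L) : Prop :=
  forall phi : form L,
    @sat L X1 (Xs (s0 X1)) None phi <-> @sat L X2 (Xs (s0 X2)) None phi.

Section Runs.
Variable L : Type.
Variable X : TSI L.

Fixpoint endst (s : St X) (p : list (trans X)) : St X :=
  match p with
  | [] => s
  | t :: p' => endst (tgt t) p'
  end.

Definition run_end (p : list (trans X)) : St X := endst (s0 X) p.

(* order of the labelled poset of a run (indices 0..k-1) *)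
Definition pord (p : list (trans X)) : nat -> nat -> Prop :=
  clos_refl_trans nat (fun i j => i < j /\ j < length p /\
     exists ti tj, nth_error p i = Some ti /\ nth_error p j = Some tj /\
                   ~ I ti tj).

Definition bwd_en (p : list (trans X)) (i : nat) : Prop :=
  i < length p /\
  forall j ti tj, i < j -> nth_error p i = Some ti -> nth_error p j = Some tj ->
    I ti tj.

(* shifting an independent transition t past the rest of a run:
   t=(s,a,s1), u=(s1,b,q) become u'=(s,b,s2), t'=(s2,a,q) *)
Inductive shift : trans X -> list (trans X) -> list (trans X) -> Prop :=
  | shift_nil : forall t, shift t [] []
  | shift_cons : forall t u us u' us',
      I t u ->
      src u' = src t -> lab u' = lab u ->
      I t u' -> I u' (tgt u', lab t, tgt u) ->
      shift (tgt u', lab t, tgt u) us us' ->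
      shift t (u :: us) (u' :: us').

Definition rem (p : list (trans X)) (i : nat) (p' : list (trans X)) : Prop :=
  exists t rest, nth_error p i = Some t /\
    shift t (skipn (S i) p) rest /\ p' = firstn i p ++ rest.

Definition last_indep (p : list (trans X)) (u : trans X) : Prop :=
  match rev p with
  | [] => False
  | t :: _ => I t u
  end.

End Runs.

Definition lp_iso (L : Type) (X1 X2 : TSI L)
           (p1 : list (trans X1)) (p2 : list (trans X2)) : Prop :=
  length p1 = length p2 /\
  exists f : nat -> nat,
    (forall i, i < length p1 -> f i < length p2) /\
    (forall i j, i < length p1 -> j < length p1 -> f i = f j -> i = j) /\
    (forall i t, nth_error p1 i = Some t ->
        exists t', nth_error p2 (f i) = Some t' /\ lab t' = lab t) /\
    (forall i j, i < length p1 -> j < length p1 ->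
        (pord p1 i j <-> pord p2 (f i) (f j))).

Definition sync (L : Type) (X1 X2 : TSI L)
           (p1 : list (trans X1)) (u : trans X1)
           (p2 : list (trans X2)) (v : trans X2) : Prop :=
  (last_indep p1 u <-> last_indep p2 v) /\
  lp_iso (p1 ++ [u]) (p2 ++ [v]).

(* A set of positions from which every move of Adam has an answer of Eve
   staying in the set (Eve wins all infinite plays). *)
Definition eve_invariant (L : Type) (X1 X2 : TSI L)
    (Rel : list (trans X1) -> list (trans X2) -> Prop) : Prop :=
  forall p1 p2, Rel p1 p2 ->
    (forall u, inT u -> src u = run_end p1 ->
       exists v, inT v /\ src v = run_end p2 /\ lab v = lab u /\
                 sync p1 u p2 v /\ Rel (p1 ++ [u]) (p2 ++ [v])) /\
    (forall v, inT v -> src v = run_end p2 ->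
       exists u, inT u /\ src u = run_end p1 /\ lab u = lab v /\
                 sync p1 u p2 v /\ Rel (p1 ++ [u]) (p2 ++ [v])) /\
    (forall i p1', bwd_en p1 i -> rem p1 i p1' ->
       exists p2', bwd_en p2 i /\ rem p2 i p2' /\ lp_iso p1' p2' /\ Rel p1' p2') /\
    (forall i p2', bwd_en p2 i -> rem p2 i p2' ->
       exists p1', bwd_en p1 i /\ rem p1 i p1' /\ lp_iso p1' p2' /\ Rel p1' p2').

(* T1 ~_hhpb T2: Eve has a winning strategy from (eps, eps) *)
Definition hhpb (L : Type) (X1 X2 : TSI L) : Prop :=
  exists Rel : list (trans X1) -> list (trans X2) -> Prop, Rel [] [] /\ @eve_invariant L X1 X2 Rel.

(* Main.v *)
From Stdlib Require Import List Relations Arith Lia Classical FunctionalExtensionality PropExtensionality.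
From mathcomp Require classical_sets.
Require Import Defs.
Import ListNotations.

Set Implicit Arguments.
Unset Strict Implicit.

(** Inclusion.  Let Eve win the game, let the runs [p1], [p2] be related by her
    strategy, and let Adam's formula select a maximal conflict-free set [M] at the
    end of [p1].  A formula mentions finitely many labels, so by image-finiteness
    only a finite part [l] of [M] matters, to which finitely many members of [M] are
    added that exclude every other transition with a relevant label.  Playing [l]
    one after the other, then deleting in turn all its transitions but one, yields
    an answer to each single element of [l]; as backwards enabled positions
    correspond, the answers are pairwise independent, and Zorn's lemma extends
    them to a maximal conflict-free set.  A superfluous relevant element of that
    set could be played after [l] and answered by a transition independent of all
    of [l], which [l] excludes.  Transitions commuted past each other are tracked
    through the equivalence [simT], whose classes meet each source state at most
    once by (A1).

    Strictness.  Over concurrent events [ea], [eb], add conflicting events [eca]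
    (caused by [ea]) and [ecb] (caused by [eb]) with the same label.  A further
    conflicting event [ecab] of that label, caused by both, is invisible to TFL,
    which compares it only with the last transition and so confuses it with
    [ecb] or [eca]; but it changes the labelled poset of the run. *)

(** * Simulations for TFL *)

Section Support.
Variables (L : Type) (X : TSI L).

Lemma seteq_eq (M N : tset X) : seteq M N -> M = N.
Proof.
  intros H. apply functional_extensionality. intros t. apply propositional_extensionality, H.
Qed.

Definition max_cf (s : St X) (M : tset X) : Prop :=
  (exists t, M t) /\ conflict_free M /\ sqsub M (Xs s).

Lemma max_cf_in_Xs (s : St X) (M : tset X) t : max_cf s M -> M t -> Xs s t.
Proof. intros (_ & _ & H & _). apply H. Qed.

(** So [fdiam_ot] has only two kinds of choices at a full support set. If [M] is some [Xs s'] and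
    has an element, that element forces [s' = s]; if [M] is empty, any transition of [Xs s] would
    violate maximality vacuously, so [Xs s] is empty too. *)
Lemma sqsub_Xs_cases (s : St X) (M : tset X) :
  inCalX M -> sqsub M (Xs s) -> M = Xs s \/ max_cf s M.
Proof.
  intros HM [Hsub Hmax].
  assert (Hfull : forall s', seteq M (Xs s') -> M = Xs s).
  { intros s' Hs'. apply seteq_eq. destruct (classic (exists t, M t)) as [[t Mt]|Hno].
    - assert (s' = s) as ->; [|exact Hs'].
      pose proof (Hsub _ Mt) as [_ <-]. apply Hs' in Mt as [_ <-]. reflexivity.
    - intros t; split; [apply Hsub|]. intros Xt. exfalso. apply Hmax.
      exists t; repeat split; try apply Xt; try (intros Mt; apply Hno; eauto).
      all: exfalso; apply Hno; eauto. }
  destruct HM as [[s' Hs']|[[[s' Hs']|[Hne Hcf]] _]]; eauto.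
  right; exact (conj Hne (conj Hcf (conj Hsub Hmax))).
Qed.

(** A missing element of [R] would be independent of all of [M]. Hence a further [fdiam_ot] below a
    conflict-free choice changes nothing. *)
Lemma sqsub_conflict_free (M R : tset X) :
  conflict_free R -> sqsub M R -> M = R.
Proof.
  intros (_ & _ & Hcf) [Hsub Hmax]. apply seteq_eq. intros t; split; [apply Hsub|].
  intros Rt. apply NNPP. intros nMt. apply Hmax. exists t; repeat split; auto.
  all: apply Hcf; auto; intros ->; contradiction.
Qed.

Lemma sqsub_refl (M : tset X) : sqsub M M.
Proof. split; [auto|]. intros (t & Mt & nMt & _). contradiction. Qed.

Lemma inCalX_Xs (s : St X) : inCalX (Xs s).
Proof. left. exists s. intros t. tauto. Qed.

Lemma inCalX_max_cf (s : St X) (M : tset X) : max_cf s M -> inCalX M.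
Proof. intros (A & B & C). right. split; [right; auto|eauto]. Qed.

Lemma conflict_free_extend (s : St X) (N : tset X) :
  (exists t, N t) -> (forall t, N t -> Xs s t) ->
  (forall t u, N t -> N u -> t <> u -> I t u) ->
  (forall t u : trans X, I t u -> I u t) ->
  exists M, max_cf s M /\ forall t, N t -> M t.
Proof.
  intros [n Nn] HX Hcf Isym.
  (* The condition concerns the union of [A] with [N] instead of asking that [A] contain [N]; thus
     the union of the empty chain satisfies it. *)
  pose (P := fun A : tset X => (forall t, A t -> Xs s t) /\
     forall t u, (A t \/ N t) -> (A u \/ N u) -> t <> u -> I t u).
  destruct (@classical_sets.Zorn_bigcup (trans X) P) as (A & [PA1 PA2] & HA).
  - intros F HF Hch. split.
    + intros t [B FB Bt]. exact (proj1 (HF B FB) t Bt).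
    + intros t u [[B FB Bt]|Nt] [[C FC Cu]|Nu] tu; cbn in *.
      * destruct (Hch B C FB FC) as [BC|CB].
        -- apply (proj2 (HF C FC)); auto.
        -- apply (proj2 (HF B FB)); auto.
      * apply (proj2 (HF B FB)); auto.
      * apply (proj2 (HF C FC)); auto.
      * auto.
  - assert (HMX : forall t, A t \/ N t -> Xs s t) by (intros t [?|?]; auto).
    exists (fun t => A t \/ N t). split; [|auto]. split; [eauto|]. split.
    + split; [intros t Ht; apply (HMX t Ht)|]. split.
      * exists s. intros t Ht. apply (HMX t Ht).
      * intros t u Ht Hu tu. split; auto.
        rewrite (proj2 (HMX t Ht)), (proj2 (HMX u Hu)). reflexivity.
    + split; [exact HMX|]. intros (t & Xt & nt & Ht).
      apply (HA (fun x => A x \/ x = t)).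
      * split; [intros x Ax; left; exact Ax|].
        intros H. apply nt. left. apply H. right; reflexivity.
      * split; [intros x [Ax| ->]; auto|].
        intros x y Hx Hy xy.
        assert (Hx' : (A x \/ N x) \/ x = t) by tauto.
        assert (Hy' : (A y \/ N y) \/ y = t) by tauto.
        destruct Hx' as [Hx'| ->], Hy' as [Hy'| ->].
        -- auto.
        -- apply Isym, Ht, Hx'.
        -- apply Ht, Hy'.
        -- congruence.
Qed.

End Support.

Fixpoint labels (L : Type) (phi : form L) : list L :=
  match phi with
  | ftt => []
  | fneg p => labels p
  | fand p q => labels p ++ labels q
  | fdiam_c a p => a :: labels p
  | fdiam_nc a p => a :: labels p
  | fdiam_ot p => labels p
  end.

(** Processes are related through state and last transition only; the support sets are quantified
    over in [trace_sim]. *)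
Definition state_rel (L : Type) (X1 X2 : TSI L) : Type :=
  St X1 -> option (trans X1) -> St X2 -> option (trans X2) -> Prop.

Definition matching (L : Type) (X1 X2 : TSI L) (Q : state_rel X1 X2)
    (t1 : option (trans X1)) (t2 : option (trans X2)) (r1 : trans X1) (r2 : trans X2) : Prop :=
  lab r1 = lab r2 /\ (leA t1 r1 <-> leA t2 r2) /\ (ominusA t1 r1 <-> ominusA t2 r2) /\
  Q (tgt r1) (Some r1) (tgt r2) (Some r2).

(** [K] holds the relevant labels. Restricting to finitely many of them lets image-finiteness bound
    the transitions to be answered. *)
Definition matched (L : Type) (X1 X2 : TSI L) (K : L -> Prop) (Q : state_rel X1 X2)
    t1 t2 (R1 : tset X1) (R2 : tset X2) : Prop :=
  (forall r1, R1 r1 -> K (lab r1) -> exists r2, R2 r2 /\ matching Q t1 t2 r1 r2) /\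
  (forall r2, R2 r2 -> K (lab r2) -> exists r1, R1 r1 /\ matching Q t1 t2 r1 r2).

(** Only choices of maximal conflict-free sets on the left are answered here; those on the right
    come from [trace_sim] for [inverse Q]. *)
Definition trace_sim (L : Type) (X1 X2 : TSI L) (K : L -> Prop) (Q : state_rel X1 X2) : Prop :=
  forall s1 t1 s2 t2, Q s1 t1 s2 t2 ->
    matched K Q t1 t2 (Xs s1) (Xs s2) /\
    forall M1, max_cf s1 M1 -> exists M2, max_cf s2 M2 /\ matched K Q t1 t2 M1 M2.

Definition inverse (L : Type) (X1 X2 : TSI L) (Q : state_rel X1 X2) : state_rel X2 X1 :=
  fun s2 t2 s1 t1 => Q s1 t1 s2 t2.

Lemma matched_inverse (L : Type) (X1 X2 : TSI L) K (Q : state_rel X1 X2) t1 t2 R1 R2 :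
  matched K (inverse Q) t2 t1 R2 R1 -> matched K Q t1 t2 R1 R2.
Proof.
  intros [H1 H2]; split; intros r Rr Kr.
  - destruct (H2 r Rr Kr) as (r' & R' & E & A & B & C). exists r'; repeat split; auto; tauto.
  - destruct (H1 r Rr Kr) as (r' & R' & E & A & B & C). exists r'; repeat split; auto; tauto.
Qed.

(** One implication suffices because the induction on [phi] leaves the systems and [Q] general: at a
    negation they are exchanged and [Q] becomes [inverse Q]. *)
Lemma trace_sim_sat_imp (L : Type) (K : L -> Prop) phi :
  (forall a, In a (labels phi) -> K a) ->
  forall (X1 X2 : TSI L) (Q : state_rel X1 X2),
  trace_sim K Q -> trace_sim K (inverse Q) ->
  forall s1 t1 s2 t2 (R1 : tset X1) (R2 : tset X2),
    Q s1 t1 s2 t2 ->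
    (R1 = Xs s1 /\ R2 = Xs s2) \/ (max_cf s1 R1 /\ max_cf s2 R2) ->
    matched K Q t1 t2 R1 R2 ->
    sat R1 t1 phi -> sat R2 t2 phi.
Proof.
  induction phi as [|p IH|p IHp q IHq|a p IH|a p IH|p IH];
    intros HK X1 X2 Q HQ HQ' s1 t1 s2 t2 R1 R2 H HR Hm; cbn in *.
  - auto.
  - intros Hn Hp. apply Hn. revert Hp.
    apply (IH HK X2 X1 (inverse Q)) with (s1 := s2) (s2 := s1); auto; [tauto|].
    apply matched_inverse, Hm.
  - intros [Hp Hq]. split; [revert Hp; apply (IHp) with Q s1 s2|revert Hq; apply IHq with Q s1 s2];
      auto; intros a Ha; apply HK, in_or_app; auto.
  - intros (r & Rr & Er & Lr & Sr).
    destruct (proj1 Hm r Rr) as (r' & R' & E & A & B & C); [rewrite Er; auto|].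
    exists r'. split; [auto|]. split; [congruence|]. split; [tauto|]. revert Sr.
    apply IH with Q (tgt r) (tgt r'); auto.
    + apply (HQ _ _ _ _ C).
  - intros (r & Rr & Er & Lr & Sr).
    destruct (proj1 Hm r Rr) as (r' & R' & E & A & B & C); [rewrite Er; auto|].
    exists r'. split; [auto|]. split; [congruence|]. split; [tauto|]. revert Sr.
    apply IH with Q (tgt r) (tgt r'); auto.
    + apply (HQ _ _ _ _ C).
  - intros (M & HM & HMR & Hs). destruct HR as [[-> ->]|[C1 C2]].
    + destruct (sqsub_Xs_cases HM HMR) as [->|Hcf].
      * exists (Xs s2). split; [apply inCalX_Xs|]. split; [apply sqsub_refl|].
        revert Hs. apply IH with Q s1 s2; auto.
      * destruct (proj2 (HQ _ _ _ _ H) M Hcf) as (M2 & HM2 & Hmm).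
        exists M2. split; [eapply inCalX_max_cf; eauto|]. split; [apply HM2|].
        revert Hs. apply IH with Q s1 s2; auto.
    + exists R2. split; [eapply inCalX_max_cf; eauto|]. split; [apply sqsub_refl|].
      rewrite (sqsub_conflict_free (proj1 (proj2 C1)) HMR) in Hs.
      revert Hs. apply IH with Q s1 s2; auto.
Qed.

Theorem trace_sim_sat (L : Type) (X1 X2 : TSI L) (K : L -> Prop) (Q : state_rel X1 X2) phi s1 t1 s2 t2 :
  trace_sim K Q -> trace_sim K (inverse Q) -> (forall a, In a (labels phi) -> K a) ->
  Q s1 t1 s2 t2 ->
  sat (Xs s1) t1 phi <-> sat (Xs s2) t2 phi.
Proof.
  intros HQ HQ' HK H. split.
  - apply trace_sim_sat_imp with K Q s1 s2; auto.
    + apply (HQ _ _ _ _ H).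
  - apply trace_sim_sat_imp with K (inverse Q) s2 s1; auto.
    + apply (HQ' _ _ _ _ H).
Qed.

(** * Commuting independent transitions *)

Section Transitions.
Variables (L : Type) (X : TSI L).
Hypothesis HX : is_TSI X.

Lemma I_inT (t u : trans X) : I t u -> inT t.
Proof. intros H. apply (proj1 HX _ _ H). Qed.

Lemma I_irrefl (t : trans X) : ~ I t t.
Proof. apply HX. Qed.

Lemma I_sym (t u : trans X) : I t u -> I u t.
Proof. apply HX. Qed.

Lemma I_simT (t t' u u' : trans X) : simT t t' -> simT u u' -> I t u -> I t' u'.
Proof.
  destruct HX as (_ & _ & Hsym & _ & _ & _ & H4 & _). intros Ht Hu H.
  apply (H4 _ _ Ht), Hsym, (H4 _ _ Hu), Hsym, H.
Qed.

Lemma simT_lab (t t' : trans X) : simT t t' -> lab t = lab t'.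
Proof. induction 1 as [t t' [H _]| | |]; congruence. Qed.

(** This is (A1), as equivalent transitions share their label. It identifies a transition after it
    has been moved along a run and back. *)
Lemma simT_src_inj (t t' : trans X) : simT t t' -> src t = src t' -> t = t'.
Proof.
  intros H Hs. pose proof (simT_lab H) as Hl.
  destruct HX as (_ & _ & _ & H1 & _).
  destruct t as [[s a] q], t' as [[s' a'] q']; cbn in *; subst.
  rewrite (H1 _ _ _ _ H). reflexivity.
Qed.

(** (A2) completes the square, and the square itself witnesses [prec u u']. *)
Lemma residual (t u : trans X) :
  I t u -> src u = src t -> exists u', inT u' /\ src u' = tgt t /\ simT u u'.
Proof.
  destruct t as [[s a] s1], u as [[s' b] s2]; cbn. intros H ->.
  pose proof HX as (H0 & _ & Hsym & _ & H2 & _).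
  destruct (H2 _ _ _ _ _ H) as (q & Hq & Hq').
  exists (s1, b, q). split; [apply (H0 _ _ Hq)|]. split; [reflexivity|].
  apply rst_step. split; [reflexivity|]. exists a. cbn. auto.
Qed.

(** By (A3). All conclusions but the last are premises of [shift_cons]; the last one allows the
    moved copy of [t] to be shifted further. *)
Lemma swap (t u : trans X) :
  I t u -> src u = tgt t ->
  exists u', src u' = src t /\ lab u' = lab u /\ I t u' /\
    I u' (tgt u', lab t, tgt u) /\ simT t (tgt u', lab t, tgt u).
Proof.
  destruct t as [[s a] s1], u as [[s' b] q]; cbn. intros H ->.
  pose proof HX as (H0 & _ & Hsym & _ & _ & H3 & _).
  destruct (H3 _ _ _ _ _ H) as (s2 & Hq & Hq').
  exists (s, b, s2). cbn. repeat split; auto.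
  apply rst_step. split; [reflexivity|]. exists b. cbn. auto.
Qed.

Fixpoint path (s : St X) (w : list (trans X)) : Prop :=
  match w with
  | [] => True
  | t :: w' => inT t /\ src t = s /\ path (tgt t) w'
  end.

Lemma path_app (s : St X) (p w : list (trans X)) :
  path s (p ++ w) <-> path s p /\ path (endst s p) w.
Proof.
  revert s. induction p as [|t p IH]; intros s; cbn; [tauto|]. rewrite IH. tauto.
Qed.

Lemma path_snoc (s : St X) (p : list (trans X)) t :
  path s (p ++ [t]) <-> path s p /\ Xs (endst s p) t.
Proof. rewrite path_app. unfold Xs. cbn. tauto. Qed.

Lemma endst_app (s : St X) (p w : list (trans X)) :
  endst s (p ++ w) = endst (endst s p) w.
Proof. revert s. induction p; intros s; cbn; auto. Qed.

(** Each square crossed by [t] witnesses [prec u' u], so a deletion alters the rest of a run only up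
    to [simT]. *)
Lemma shift_path (t : trans X) w w' :
  shift t w w' -> inT t -> path (tgt t) w -> path (src t) w' /\ Forall2 (@simT L X) w w'.
Proof.
  induction 1 as [|t u us u' us' Htu Hs Hl Htu' Hut Hsh IH]; intros Ht Hp; [cbn; auto|].
  destruct Hp as (Hu & Hsu & Hp). cbn in Hp.
  destruct IH as [IH1 IH2]; [apply (proj1 HX _ _ Hut)|exact Hp|]. cbn in IH1.
  split; [cbn; repeat split; auto; apply (I_inT Hut)|].
  constructor; [|exact IH2]. apply rst_sym, rst_step. split; [auto|].
  exists (lab t). rewrite Hs, Hsu. destruct t as [[s a] s1]; cbn in *.
  repeat split; auto. apply I_sym. exact Htu'.
Qed.

(** The shifted transition changes at every square but stays in its class, so by (A4) it remains
    independent of the tail. *)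
Lemma shift_exists (t : trans X) w :
  path (tgt t) w -> Forall (I t) w -> exists w', shift t w w'.
Proof.
  revert t. induction w as [|u w IH]; intros t Hp Hf.
  - exists []. constructor.
  - destruct Hp as (Hu & Hsu & Hp). inversion Hf as [|? ? Htu Hf']; subst.
    destruct (swap Htu Hsu) as (u' & A & B & C & D & E).
    destruct (IH (tgt u', lab t, tgt u)) as (w' & Hw').
    + exact Hp.
    + revert Hf'. apply Forall_impl. intros y. apply I_simT; [exact E|apply rst_refl].
    + exists (u' :: w'). constructor; auto.
Qed.

Lemma residual_path (s : St X) w u :
  path s w -> Xs s u -> Forall (I u) w ->
  exists u', Xs (endst s w) u' /\ simT u u'.
Proof.
  revert s u. induction w as [|t w IH]; intros s u Hp Hu Hf.
  - exists u. split; [exact Hu|apply rst_refl].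
  - destruct Hp as (Ht & Hs & Hp). inversion Hf as [|? ? Hut Hf']; subst.
    destruct (residual (I_sym Hut) (proj2 Hu)) as (u1 & A & B & C).
    destruct (IH (tgt t) u1 Hp) as (u' & Hu' & Hsim).
    + split; auto.
    + revert Hf'. apply Forall_impl. intros y. apply I_simT; [exact C|apply rst_refl].
    + exists u'. split; [exact Hu'|]. eapply rst_trans; eassumption.
Qed.

Lemma Forall_I_simT (t t' : trans X) l l' :
  simT t t' -> Forall2 (@simT L X) l l' -> Forall (I t) l -> Forall (I t') l'.
Proof.
  intros Ht Hl. induction Hl; intros Hf; [constructor|].
  inversion Hf; subst. constructor; eauto using I_simT.
Qed.

Lemma ForallOrdPairs_I_simT l l' :
  Forall2 (@simT L X) l l' -> ForallOrdPairs (@I L X) l -> ForallOrdPairs (@I L X) l'.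
Proof.
  induction 1 as [|t t' l l' Ht Hl IH]; intros Hf; [constructor|].
  inversion Hf; subst. constructor; eauto using Forall_I_simT.
Qed.

Lemma ForallOrdPairs_snoc l (t : trans X) :
  ForallOrdPairs (@I L X) l -> Forall (I t) l -> ForallOrdPairs (@I L X) (l ++ [t]).
Proof.
  induction 1 as [|u l Hu Hl IH]; intros Hf; cbn; [repeat constructor|].
  inversion Hf; subst. constructor; auto.
  apply Forall_app; split; auto. constructor; auto. apply I_sym; auto.
Qed.

Lemma ForallOrdPairs_snoc_inv l (t : trans X) :
  ForallOrdPairs (@I L X) (l ++ [t]) -> Forall (I t) l.
Proof.
  induction l as [|u l IH]; intros Hf; [constructor|].
  inversion Hf as [|? ? H1 H2]; subst. apply Forall_app in H1 as [H1 H3].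
  inversion H3; subst. constructor; auto using I_sym.
Qed.

Lemma ForallOrdPairs_app_inv (a b : list (trans X)) :
  ForallOrdPairs (@I L X) (a ++ b) -> ForallOrdPairs (@I L X) a /\ ForallOrdPairs (@I L X) b.
Proof.
  induction a as [|u a IH]; cbn; intros Hf; [split; [constructor|auto]|].
  inversion Hf as [|? ? H1 H2]; subst. apply Forall_app in H1 as [H1 _].
  destruct (IH H2). split; auto. constructor; auto.
Qed.

(** Together with [rem_split] this replaces indices by splittings [q ++ t :: w], which suit
    induction on runs. *)
Lemma bwd_en_split (q : list (trans X)) t w :
  bwd_en (q ++ t :: w) (length q) <-> Forall (I t) w.
Proof.
  unfold bwd_en. rewrite length_app. cbn. split.
  - intros [_ H]. apply Forall_forall. intros y Hy.
    destruct (In_nth_error _ _ Hy) as (k & Hk).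
    apply (H (length q + S k)); [lia| |].
    + rewrite nth_error_app2, Nat.sub_diag by lia. reflexivity.
    + rewrite nth_error_app2 by lia.
      replace (length q + S k - length q) with (S k) by lia. exact Hk.
  - intros H. split; [lia|]. intros j ti tj Hj Hi Hn.
    rewrite nth_error_app2, Nat.sub_diag in Hi by lia. injection Hi as <-.
    rewrite nth_error_app2 in Hn by lia.
    destruct (j - length q) as [|k] eqn:E; [lia|].
    rewrite Forall_forall in H. apply H. eapply nth_error_In. exact Hn.
Qed.

Lemma rem_split (q : list (trans X)) t w p' :
  rem (q ++ t :: w) (length q) p' <-> exists w', shift t w w' /\ p' = q ++ w'.
Proof.
  unfold rem.
  replace (skipn (S (length q)) (q ++ t :: w)) with w.
  2:{ rewrite skipn_app. replace (S (length q) - length q) with 1 by lia.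
      rewrite skipn_all2 by lia. reflexivity. }
  rewrite firstn_app, Nat.sub_diag, firstn_all, app_nil_r.
  rewrite nth_error_app2, Nat.sub_diag by lia. cbn. split.
  - intros (t' & w' & [= <-] & Hs & ->). eauto.
  - intros (w' & Hs & ->). eauto.
Qed.

(** * Finite approximation of maximal conflict-free sets *)

Lemma finite_Xs (s : St X) (K : list L) :
  exists e, forall t, Xs s t -> In (lab t) K -> In t e.
Proof.
  induction K as [|a K [e He]]; [exists []; cbn; tauto|].
  destruct HX as (_ & _ & _ & _ & _ & _ & _ & Hfin).
  destruct (Hfin s a) as [l Hl].
  exists (map (fun q => (s, a, q)) l ++ e). intros [[s' a'] q] [Ht Hs] [Ha|Ha]; cbn in *; subst.
  - apply in_or_app. left. apply in_map_iff. exists q. split; auto.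
  - apply in_or_app. right. apply He; [split|]; auto.
Qed.

(** For each of the finitely many enabled transitions with a label in [K], one member of [M] not
    independent of it is put into [l]: the transition itself if it lies in [M], otherwise one
    provided by maximality. *)
Lemma max_cf_finite_part (s : St X) (M : tset X) (K : list L) :
  max_cf s M ->
  exists l, (forall t, In t l -> M t) /\ NoDup l /\ l <> [] /\
    forall t, Xs s t -> In (lab t) K ->
      (M t -> In t l) /\ exists m, In m l /\ ~ I t m.
Proof.
  intros HM. destruct (finite_Xs s K) as [e He].
  cut (exists l, (forall t, In t l -> M t) /\ NoDup l /\ l <> [] /\
    forall t, In t e -> Xs s t -> (M t -> In t l) /\ exists m, In m l /\ ~ I t m).
  { intros (l & A & B & C & D). exists l. auto 6. }
  clear He. destruct HM as ([m0 Mm0] & Hcf & Hsub & Hmax).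
  induction e as [|t e (l & A & B & C & D)].
  (* Starting from [m0] keeps [l] non-empty, as required later of the answering set. *)
  { exists [m0]. split; [intros t [<-|[]]; exact Mm0|].
    split; [repeat constructor; auto|]. split; easy. }
  assert (Hm : Xs s t -> exists m, M m /\ ~ I t m /\ (M t -> m = t)).
  { intros Xt. destruct (classic (M t)) as [Mt|nMt].
    - exists t. repeat split; auto. apply I_irrefl.
    - apply NNPP. intros Hno. apply Hmax. exists t. split; [exact Xt|]. split; [exact nMt|].
      intros m Mm. split.
      + rewrite (proj2 Xt). symmetry. apply (Hsub _ Mm).
      + apply NNPP. intros nI. apply Hno. exists m. tauto. }
  destruct (classic (Xs s t)) as [Xt|nXt].
  2:{ exists l. split; [exact A|]. split; [exact B|]. split; [exact C|].
      intros u [<-|Hu] Xu; [contradiction|]. auto. }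
  destruct (Hm Xt) as (m & Mm & nI & Em).
  destruct (classic (In m l)) as [Hin|nin].
  - exists l. split; [exact A|]. split; [exact B|]. split; [exact C|].
    intros u [<-|Hu] Xu; [|auto]. split; [|eauto].
    intros Mt. rewrite <- (Em Mt). exact Hin.
  - exists (m :: l). split; [intros x [<-|Hx]; auto|].
    split; [constructor; auto|]. split; [easy|].
    intros u [<-|Hu] Xu; [split; [left; auto|exists m; cbn; auto]|].
    destruct (D u Hu Xu) as (E & m' & ? & ?).
    split; [right; auto|exists m'; cbn; auto].
Qed.

Lemma conflict_free_ForallOrdPairs (M : tset X) l :
  conflict_free M -> (forall t, In t l -> M t) -> NoDup l -> ForallOrdPairs (@I L X) l.
Proof.
  intros (_ & _ & Hcf) Hl Hd. induction Hd as [|t l Ht Hd IH]; [constructor|].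
  constructor.
  - apply Forall_forall. intros u Hu. apply Hcf; cbn in *; auto. intros ->; contradiction.
  - apply IH. cbn in Hl. auto.
Qed.

End Transitions.

(** * From the game to TFL *)

(* The part of Eve's winning condition the argument needs: isomorphism of the
   labelled posets enters only through the requirement that backwards enabled
   positions correspond. *)
Definition hp_sim (L : Type) (X1 X2 : TSI L)
    (R : list (trans X1) -> list (trans X2) -> Prop) : Prop :=
  forall p1 p2, R p1 p2 ->
    map (@lab L X1) p1 = map (@lab L X2) p2 /\ path (s0 X1) p1 /\ path (s0 X2) p2 /\
    (forall u, Xs (run_end p1) u ->
       exists v, Xs (run_end p2) v /\ R (p1 ++ [u]) (p2 ++ [v])) /\
    (forall q1 t1 w1 q2 t2 w2,
       p1 = q1 ++ t1 :: w1 -> p2 = q2 ++ t2 :: w2 -> length q1 = length q2 ->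
       Forall (I t1) w1 ->
       Forall (I t2) w2 /\
       exists w1' w2', shift t1 w1 w1' /\ shift t2 w2 w2' /\ R (q1 ++ w1') (q2 ++ w2')).

Definition flip (A B : Type) (R : A -> B -> Prop) : B -> A -> Prop := fun b a => R a b.

Lemma shift_lab (L : Type) (X : TSI L) (t : trans X) w w' :
  shift t w w' -> map (@lab L X) w' = map (@lab L X) w.
Proof. induction 1; cbn; congruence. Qed.

Lemma path_run_split (L : Type) (X : TSI L) (q : list (trans X)) t w :
  path (s0 X) (q ++ t :: w) -> path (s0 X) q /\ inT t /\ src t = run_end q /\ path (tgt t) w.
Proof. rewrite path_app. cbn. unfold run_end. tauto. Qed.

Lemma path_shift (L : Type) (X : TSI L) (HX : is_TSI X) (q : list (trans X)) t w w' :
  path (s0 X) (q ++ t :: w) -> shift t w w' -> path (s0 X) (q ++ w').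
Proof.
  intros (A & B & C & D)%path_run_split Hs. apply path_app. split; [exact A|].
  fold (run_end q). rewrite <- C. apply (shift_path HX Hs B D).
Qed.

Lemma map_split (A1 A2 B : Type) (f : A1 -> B) (g : A2 -> B) a1 b1 a2 b2 :
  map f (a1 ++ b1) = map g (a2 ++ b2) -> length a1 = length a2 ->
  map f a1 = map g a2 /\ map f b1 = map g b2.
Proof.
  revert a2. induction a1 as [|x a1 IH]; intros [|y a2] H E; try discriminate; [auto|].
  injection E as E. injection H as Hx H. destruct (IH _ H E). cbn. split; congruence.
Qed.

(** Only Adam's moves in the left system are considered, so that the lemma serves both directions.
    An invariant need not record equal labels or that its lists are runs, so these conditions are
    conjoined to [Rel]; deleting at equal positions preserves them. *)
Lemma game_hp_sim (L : Type) (X1 X2 : TSI L) (HX1 : is_TSI X1) (HX2 : is_TSI X2)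
    (Rel : list (trans X1) -> list (trans X2) -> Prop) :
  (forall p1 p2, Rel p1 p2 ->
    (forall u, inT u -> src u = run_end p1 ->
       exists v, inT v /\ src v = run_end p2 /\ lab v = lab u /\ Rel (p1 ++ [u]) (p2 ++ [v])) /\
    (forall i p1', bwd_en p1 i -> rem p1 i p1' ->
       exists p2', bwd_en p2 i /\ rem p2 i p2' /\ Rel p1' p2')) ->
  hp_sim (fun p1 p2 => Rel p1 p2 /\ map (@lab L X1) p1 = map (@lab L X2) p2 /\
            path (s0 X1) p1 /\ path (s0 X2) p2).
Proof.
  intros H p1 p2 (HR & Hl & P1 & P2). destruct (H _ _ HR) as (F1 & B1).
  split; [exact Hl|]. split; [exact P1|]. split; [exact P2|]. split.
  - intros u [Hu Eu]. destruct (F1 u Hu Eu) as (v & Hv & Ev & Lv & HR').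
    exists v. split; [split; auto|]. split; [exact HR'|].
    rewrite !map_app, !path_snoc. cbn. rewrite Hl, Lv. unfold Xs. auto 6.
  - intros q1 t1 w1 q2 t2 w2 -> -> Hq Hf.
    destruct (path_run_split P1) as (_ & _ & _ & Pw1).
    destruct (shift_exists HX1 Pw1 Hf) as (w1' & Hs1).
    destruct (B1 (length q1) (q1 ++ w1')) as (p2' & Hb & Hr & HR').
    { apply bwd_en_split, Hf. }
    { apply rem_split. eauto. }
    rewrite Hq in Hb, Hr. apply bwd_en_split in Hb. apply rem_split in Hr as (w2' & Hs2 & ->).
    split; [exact Hb|]. exists w1', w2'. split; [exact Hs1|]. split; [exact Hs2|].
    split; [exact HR'|]. split; [|eauto using path_shift].
    destruct (map_split Hl Hq) as [El Er]. injection Er as _ Er.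
    rewrite !map_app, El, (shift_lab Hs1), (shift_lab Hs2), Er. reflexivity.
Qed.

Lemma hhpb_hp_sim (L : Type) (X1 X2 : TSI L) :
  is_TSI X1 -> is_TSI X2 -> hhpb X1 X2 ->
  exists R : list (trans X1) -> list (trans X2) -> Prop,
    R [] [] /\ hp_sim R /\ hp_sim (flip R).
Proof.
  intros HX1 HX2 (Rel & H0 & H).
  assert (A : hp_sim (fun p1 p2 => Rel p1 p2 /\ map (@lab L X1) p1 = map (@lab L X2) p2 /\
                 path (s0 X1) p1 /\ path (s0 X2) p2)).
  { apply game_hp_sim; auto. intros p1 p2 HR. destruct (H _ _ HR) as (F & _ & B & _). split.
    - intros u Hu Eu. destruct (F u Hu Eu) as (v & ?). exists v. tauto.
    - intros i p' Hb Hr. destruct (B i p' Hb Hr) as (q & ?). exists q. tauto. }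
  assert (B : hp_sim (fun p2 p1 => flip Rel p2 p1 /\ map (@lab L X2) p2 = map (@lab L X1) p1 /\
                 path (s0 X2) p2 /\ path (s0 X1) p1)).
  { apply game_hp_sim; auto. intros p2 p1 HR. destruct (H _ _ HR) as (_ & F & _ & B). split.
    - intros u Hu Eu. destruct (F u Hu Eu) as (v & ?). exists v. unfold flip. tauto.
    - intros i p' Hb Hr. destruct (B i p' Hb Hr) as (q & ?). exists q. unfold flip. tauto. }
  eexists. split; [|split; [exact A|]]; [cbn; auto|].
  (* [B] speaks of the same relation with label equation and run conditions turned around; only
     reordering remains. *)
  intros p2 p1 (HR & Hl & P1 & P2).
  destruct (B p2 p1) as (C1 & C2 & C3 & C4 & C5); [unfold flip; auto|].
  split; [exact C1|]. split; [exact C2|]. split; [exact C3|]. split.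
  - intros u Hu. destruct (C4 u Hu) as (v & Hv & D1 & D2 & D3 & D4).
    exists v. split; [exact Hv|]. split; [exact D1|auto].
  - intros q1 t1 w1 q2 t2 w2 E1 E2 Hq Hf.
    destruct (C5 _ _ _ _ _ _ E1 E2 Hq Hf) as (K & w1' & w2' & S1 & S2 & D1 & D2 & D3 & D4).
    split; [exact K|]. exists w1', w2'. split; [exact S1|]. split; [exact S2|].
    split; [exact D1|auto].
Qed.

(** * Playing and deleting families of independent transitions *)

Section Multistep.
Variables (L : Type) (X1 X2 : TSI L).
Hypotheses (HX1 : is_TSI X1) (HX2 : is_TSI X2).
Variable R : list (trans X1) -> list (trans X2) -> Prop.
Hypothesis HR : hp_sim R.

Lemma hp_sim_length p1 p2 : R p1 p2 -> length p1 = length p2.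
Proof.
  intros H. apply HR in H as (H & _).
  rewrite <- (length_map (@lab L X1)), H, length_map. reflexivity.
Qed.

Lemma hp_sim_snoc p1 p2 t1 t2 :
  R (p1 ++ [t1]) (p2 ++ [t2]) ->
  length p1 = length p2 /\ lab t1 = lab t2 /\ Xs (run_end p1) t1 /\ Xs (run_end p2) t2.
Proof.
  intros H. pose proof (hp_sim_length H) as Hl. rewrite !length_app in Hl. cbn in Hl.
  destruct (HR H) as (Hm & P1 & P2 & _).
  apply path_snoc in P1, P2. apply map_split in Hm as [_ Hm]; [|lia]. injection Hm as Hm.
  repeat split; try apply P1; try apply P2; auto. lia.
Qed.

(** After the first move the other transitions continue as residuals in the same [simT] classes,
    still pairwise independent. As the tail is replaced, the induction is on the length. *)
Lemma multistep l p1 p2 :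
  R p1 p2 -> (forall t, In t l -> Xs (run_end p1) t) -> ForallOrdPairs (@I L X1) l ->
  exists w1 w2, Forall2 (@simT L X1) l w1 /\ length w1 = length w2 /\ R (p1 ++ w1) (p2 ++ w2).
Proof.
  remember (length l) as n eqn:Hn. revert l Hn p1 p2.
  induction n as [|n IH]; intros [|t l] Hn p1 p2 H Hl Hf; try discriminate.
  - exists [], []. rewrite !app_nil_r. auto.
  - injection Hn as Hn. inversion Hf as [|? ? Ht Hf']; subst.
    destruct (proj1 (proj2 (proj2 (proj2 (HR H)))) t (Hl t (or_introl eq_refl))) as (v & _ & H').
    assert (Hres : exists l', Forall2 (@simT L X1) l l' /\
              forall u, In u l' -> Xs (run_end (p1 ++ [t])) u).
    { assert (Hend : run_end (p1 ++ [t]) = tgt t)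
        by (unfold run_end; rewrite endst_app; reflexivity).
      rewrite Hend. pose proof (Hl t (or_introl eq_refl)) as [_ Hst].
      assert (Hl' : forall u, In u l -> src u = src t).
      { intros u Hu. rewrite Hst. apply Hl. right; exact Hu. }
      clear - HX1 Ht Hl'. induction l as [|u l IHl].
      - exists []. split; [constructor|intros u []].
      - inversion Ht; subst. destruct IHl as (l' & A & B); [auto|cbn in Hl'; auto|].
        destruct (residual (t := t) (u := u) HX1) as (u' & C & D & E); [auto|apply Hl'; left; auto|].
        exists (u' :: l'). split; [constructor; auto|].
        intros x [<-|Hx]; [split; auto|auto]. }
    destruct Hres as (l' & Hs & Hl').
    destruct (IH l' (Forall2_length Hs) _ _ H' Hl') as (w1 & w2 & A & B & C).
    { eapply ForallOrdPairs_I_simT; eauto. }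
    exists (t :: w1), (v :: w2). rewrite <- !app_assoc in C. cbn in *.
    split; [|auto]. constructor; [apply rst_refl|].
    clear - Hs A. revert w1 A. induction Hs; intros w1 A; inversion A; subst; constructor; auto.
    eapply rst_trans; eassumption.
Qed.

Lemma delete_head p1 p2 t1 t2 w1 w2 :
  R (p1 ++ t1 :: w1) (p2 ++ t2 :: w2) -> length p1 = length p2 -> Forall (I t1) w1 ->
  Forall (I t2) w2 /\
  exists w1' w2', Forall2 (@simT L X1) w1 w1' /\ Forall2 (@simT L X2) w2 w2' /\
    R (p1 ++ w1') (p2 ++ w2').
Proof.
  intros H Hp Hf. destruct (HR H) as (_ & P1 & P2 & _ & Hd).
  destruct (Hd _ _ _ _ _ _ eq_refl eq_refl Hp Hf) as (A & w1' & w2' & S1 & S2 & H').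
  split; [exact A|]. exists w1', w2'.
  apply path_run_split in P1 as (_ & P1 & _ & P1'), P2 as (_ & P2 & _ & P2').
  split; [apply (shift_path HX1 S1 P1 P1')|]. split; [apply (shift_path HX2 S2 P2 P2')|exact H'].
Qed.

(** Every transition of [w1] is independent of the later ones, hence backwards enabled, and so is
    its counterpart in [w2]. Nothing is deleted: the prefix absorbs the transitions one by one. *)
Lemma independence_transfer w1 w2 p1 p2 :
  R (p1 ++ w1) (p2 ++ w2) -> length p1 = length p2 ->
  ForallOrdPairs (@I L X1) w1 -> ForallOrdPairs (@I L X2) w2.
Proof.
  revert p1 p2 w2. induction w1 as [|t1 w1 IH]; intros p1 p2 w2 H Hp Hf;
    pose proof (hp_sim_length H) as Hl; rewrite !length_app in Hl.
  - destruct w2; [constructor|cbn in Hl; lia].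
  - destruct w2 as [|t2 w2]; [cbn in Hl; lia|]. inversion Hf; subst.
    constructor; [eapply delete_head; eauto|].
    apply IH with (p1 ++ [t1]) (p2 ++ [t2]); auto.
    + rewrite <- !app_assoc. exact H.
    + rewrite !length_app. cbn. lia.
Qed.

Lemma delete_suffix w1 w2 p1 p2 :
  R (p1 ++ w1) (p2 ++ w2) -> length p1 = length p2 ->
  ForallOrdPairs (@I L X1) w1 -> R p1 p2.
Proof.
  remember (length w1) as n eqn:Hn. revert w1 w2 Hn.
  induction n as [|n IH]; intros w1 w2 Hn H Hp Hf;
    pose proof (hp_sim_length H) as Hl; rewrite !length_app in Hl;
    destruct w1 as [|t1 w1], w2 as [|t2 w2]; cbn in *; try lia.
  - rewrite !app_nil_r in H. exact H.
  - inversion Hf; subst.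
    destruct (delete_head H) as (_ & w1' & w2' & S1 & S2 & H'); auto.
    apply IH with w1' w2'; auto.
    + rewrite <- (Forall2_length S1). lia.
    + eapply ForallOrdPairs_I_simT; eauto.
Qed.

(** Deleting [a1] from the front moves the last transition back to the end of [p1], within its
    class. *)
Lemma delete_prefix a1 a2 x1 x2 p1 p2 :
  R (p1 ++ a1 ++ [x1]) (p2 ++ a2 ++ [x2]) -> length p1 = length p2 ->
  ForallOrdPairs (@I L X1) (a1 ++ [x1]) ->
  exists y1 y2, simT x1 y1 /\ simT x2 y2 /\ R (p1 ++ [y1]) (p2 ++ [y2]).
Proof.
  remember (length a1) as n eqn:Hn. revert a1 a2 x1 x2 Hn.
  induction n as [|n IH]; intros a1 a2 x1 x2 Hn H Hp Hf;
    pose proof (hp_sim_length H) as Hl; rewrite !length_app in Hl;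
    destruct a1 as [|t1 a1], a2 as [|t2 a2]; cbn in *; try lia.
  - exists x1, x2. split; [apply rst_refl|]. split; [apply rst_refl|exact H].
  - inversion Hf; subst.
    destruct (delete_head H) as (_ & w1' & w2' & S1 & S2 & H'); auto.
    pose proof (ForallOrdPairs_I_simT HX1 S1 ltac:(assumption)) as Hf'.
    apply Forall2_app_inv_l in S1 as (b1 & c1 & S1 & T1 & ->).
    apply Forall2_app_inv_l in S2 as (b2 & c2 & S2 & T2 & ->).
    inversion T1 as [|? z1 ? ? Z1 T1']; inversion T1'; subst.
    inversion T2 as [|? z2 ? ? Z2 T2']; inversion T2'; subst.
    destruct (IH b1 b2 z1 z2) as (y1 & y2 & Y1 & Y2 & HY); auto.
    { rewrite <- (Forall2_length S1). lia. }
    exists y1, y2. split; [eapply rst_trans; eassumption|].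
    split; [eapply rst_trans; eassumption|exact HY].
Qed.

(** For each position, first everything after it is deleted, which leaves it unchanged, then
    everything before it. *)
Lemma delete_all_but_one w1 w2 p1 p2 :
  R (p1 ++ w1) (p2 ++ w2) -> length p1 = length p2 ->
  ForallOrdPairs (@I L X1) w1 ->
  Forall2 (fun x1 x2 => exists y1 y2, simT x1 y1 /\ simT x2 y2 /\ R (p1 ++ [y1]) (p2 ++ [y2])) w1 w2.
Proof.
  intros H Hp Hf.
  (* Inducting over splittings keeps the full words fixed, since every position starts its deletions
     from the same pair of runs. *)
  cut (forall b1 b2 a1 a2, length a1 = length a2 -> w1 = a1 ++ b1 -> w2 = a2 ++ b2 ->
    Forall2 (fun x1 x2 => exists y1 y2, simT x1 y1 /\ simT x2 y2 /\
      R (p1 ++ [y1]) (p2 ++ [y2])) b1 b2).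
  { intros Hc. apply (Hc w1 w2 [] []); reflexivity. }
  pose proof (hp_sim_length H) as Hl. rewrite !length_app in Hl.
  induction b1 as [|x1 b1 IH]; intros [|x2 b2] a1 a2 Ha -> ->;
    rewrite !length_app in Hl; cbn in Hl; try lia; constructor.
  - replace (a1 ++ x1 :: b1) with ((a1 ++ [x1]) ++ b1) in * by (rewrite <- app_assoc; reflexivity).
    replace (a2 ++ x2 :: b2) with ((a2 ++ [x2]) ++ b2) in * by (rewrite <- app_assoc; reflexivity).
    apply ForallOrdPairs_app_inv in Hf as [Hf1 Hf2].
    apply delete_prefix with a1 a2; auto.
    apply delete_suffix with b1 b2; auto.
    + rewrite <- !app_assoc in *. exact H.
    + rewrite !length_app. cbn. lia.
  - apply IH with (a1 ++ [x1]) (a2 ++ [x2]).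
    + rewrite !length_app. cbn. lia.
    + rewrite <- app_assoc. reflexivity.
    + rewrite <- app_assoc. reflexivity.
Qed.

(** The default [None] stands for [t_eps] on the empty run. *)
Definition last_trans (X : TSI L) (p : list (trans X)) : option (trans X) :=
  last (map Some p) None.

Lemma last_trans_snoc (X : TSI L) (p : list (trans X)) t : last_trans (p ++ [t]) = Some t.
Proof. unfold last_trans. rewrite map_app. apply last_last. Qed.

Lemma run_end_snoc (X : TSI L) (p : list (trans X)) t : run_end (p ++ [t]) = tgt t.
Proof. unfold run_end. rewrite endst_app. reflexivity. Qed.

Definition run_ends : state_rel X1 X2 := fun s1 t1 s2 t2 =>
  exists p1 p2, R p1 p2 /\ s1 = run_end p1 /\ t1 = last_trans p1 /\
    s2 = run_end p2 /\ t2 = last_trans p2.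

End Multistep.

Section MultistepMatching.
Variables (L : Type) (X1 X2 : TSI L).
Hypotheses (HX1 : is_TSI X1) (HX2 : is_TSI X2).
Variable R : list (trans X1) -> list (trans X2) -> Prop.
Hypotheses (HR : hp_sim R) (HR' : hp_sim (flip R)).

(** Independence of the last two transitions means that the last but one is backwards enabled, and
    backwards enabledness transfers in both directions. On empty runs both sides compare with
    [t_eps]. *)
Lemma last_matching p1 p2 r1 r2 :
  R (p1 ++ [r1]) (p2 ++ [r2]) ->
  matching (run_ends R) (last_trans p1) (last_trans p2) r1 r2.
Proof.
  intros H. destruct (hp_sim_snoc HR H) as (Hl & El & [T1 S1] & [T2 S2]).
  split; [exact El|].
  assert (HE : run_ends R (tgt r1) (Some r1) (tgt r2) (Some r2)).
  { exists (p1 ++ [r1]), (p2 ++ [r2]). rewrite !run_end_snoc, !last_trans_snoc. auto. }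
  induction p1 as [|u1 q1 _] using rev_ind; destruct p2 as [|u2 q2 _] using rev_ind;
    rewrite ?length_app in Hl; cbn in Hl; try lia.
  - cbn. unfold run_end in *. cbn in *. tauto.
  - rewrite !last_trans_snoc. rewrite run_end_snoc in S1, S2. cbn.
    unfold leT, ominus.
    assert (E : I u1 r1 <-> I u2 r2).
    { rewrite <- !app_assoc in H. cbn in H. split; intros HI.
      - eapply (delete_head HX1 HX2 HR) in H as [H _]; [inversion H; auto|lia|auto].
      - eapply (delete_head HX2 HX1 HR') in H as [H _]; [inversion H; auto|lia|auto]. }
    intuition congruence.
Qed.

Lemma run_ends_trace_sim (K : list L) : trace_sim (fun a => In a K) (run_ends R).
Proof.
  intros s1 t1 s2 t2 (p1 & p2 & H & -> & -> & -> & ->).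
  pose proof (hp_sim_length HR H) as Hp.
  split.
  { split; intros r Hr _.
    - destruct (proj1 (proj2 (proj2 (proj2 (HR H)))) r Hr) as (v & Hv & H').
      exists v. split; [exact Hv|apply last_matching, H'].
    - destruct (proj1 (proj2 (proj2 (proj2 (HR' H)))) r Hr) as (v & Hv & H').
      exists v. split; [exact Hv|apply last_matching, H']. }
  intros M HM. destruct (max_cf_finite_part HX1 K HM) as (l & Hl & Hnd & Hne & HK).
  assert (HlX : forall t, In t l -> Xs (run_end p1) t).
  { intros t Ht. apply (max_cf_in_Xs HM), Hl, Ht. }
  assert (Hlf : ForallOrdPairs (@I L X1) l).
  { apply conflict_free_ForallOrdPairs with M; auto. apply HM. }
  destruct (multistep HX1 HR H HlX Hlf) as (w1 & w2 & Sw & Hw & HRw).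
  pose proof (ForallOrdPairs_I_simT HX1 Sw Hlf) as Hf1.
  pose proof (independence_transfer HX1 HX2 HR HRw Hp Hf1) as Hf2.
  assert (Hl' : exists l', Forall2 (fun x v => R (p1 ++ [x]) (p2 ++ [v])) l l' /\
                 Forall2 (@simT L X2) w2 l').
  { pose proof (delete_all_but_one HX1 HX2 HR HRw Hp Hf1) as Hd.
    clear - Sw Hd HlX HX1 HR. revert w2 Hd.
    induction Sw as [|x y l w1 Hxy Sw IH]; intros w2 Hd; inversion Hd as [|? z ? w2' Hz Hd']; subst.
    - exists []. split; constructor.
    - destruct (IH ltac:(cbn in HlX; auto) w2' Hd') as (l' & A & B).
      destruct Hz as (y1 & y2 & E1 & E2 & E3).
      (* What survives the deletions is equivalent to [x] and starts in the same state, so (A1)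
         makes it [x] itself. *)
      assert (x = y1) as ->.
      { apply (simT_src_inj HX1); [eapply rst_trans; eassumption|].
        rewrite (proj2 (HlX x (or_introl eq_refl))).
        symmetry. apply (hp_sim_snoc HR E3). }
      exists (y2 :: l'). split; constructor; auto. }
  destruct Hl' as (l' & Hll & Sw').
  pose proof (ForallOrdPairs_I_simT HX2 Sw' Hf2) as Hlf'.
  assert (Hin : forall v, In v l' -> exists x, In x l /\ R (p1 ++ [x]) (p2 ++ [v])).
  { clear - Hll. induction Hll; intros v []; subst; cbn; eauto.
    destruct (IHHll v) as (? & ? & ?); eauto. }
  assert (Hin' : forall x, In x l -> exists v, In v l' /\ R (p1 ++ [x]) (p2 ++ [v])).
  { clear - Hll. induction Hll; intros v []; subst; cbn; eauto.
    destruct (IHHll v) as (? & ? & ?); eauto. }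
  destruct (@conflict_free_extend L X2 (run_end p2) (fun v => In v l')) as (M2 & HM2 & Hsub).
  - destruct l as [|x l]; [contradiction|].
    destruct (Hin' x (or_introl eq_refl)) as (v & Hv & _). eauto.
  - intros v Hv. destruct (Hin v Hv) as (x & _ & Hx). apply (hp_sim_snoc HR Hx).
  - intros v v' Hv Hv' Hn.
    destruct (ForallOrdPairs_In Hlf' v v' Hv Hv') as [|[|]]; [contradiction|auto|].
    apply (I_sym HX2); auto.
  - apply (I_sym HX2).
  - exists M2. split; [exact HM2|]. split; intros r Mr Kr.
    + destruct (HK r (max_cf_in_Xs HM Mr) Kr) as [Hr _].
      destruct (Hin' r (Hr Mr)) as (v & Hv & Hx).
      exists v. split; [auto|apply last_matching, Hx].
    + destruct (classic (In r l')) as [Hr|nr].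
      { destruct (Hin r Hr) as (x & Hx & Hxr). exists x. split; [auto|apply last_matching, Hxr]. }
      (* A relevant [r] of [M2] outside [l'] is independent of [l'], hence of [w2], so a residual
         [r'] of it can be played after [w2]. *)
      exfalso.
      assert (Hrl : Forall (I r) l').
      { apply Forall_forall. intros v Hv. apply HM2; auto. intros ->; contradiction. }
      assert (Sw'' : Forall2 (@simT L X2) l' w2).
      { clear - Sw'. induction Sw'; constructor; auto. apply rst_sym; auto. }
      pose proof (Forall_I_simT HX2 (rst_refl _ _ r) Sw'' Hrl) as Hrw.
      destruct (HR HRw) as (_ & _ & P2 & _). apply path_app in P2 as [_ P2].
      destruct (residual_path HX2 P2 (max_cf_in_Xs HM2 Mr) Hrw) as (r' & Xr' & Sr).
      destruct (proj1 (proj2 (proj2 (proj2 (HR' HRw)))) r') as (u & Xu & HRu).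
      { unfold run_end. rewrite endst_app. exact Xr'. }
      unfold flip in HRu. rewrite <- !app_assoc in HRu.
      (* Eve's answer [u] to [r'] inherits independence from all of [w1]. *)
      assert (Hfu : ForallOrdPairs (@I L X1) (w1 ++ [u])).
      { apply (independence_transfer HX2 HX1 HR' HRu); auto.
        apply ForallOrdPairs_snoc; auto.
        apply (Forall_I_simT HX2 Sr (l := w2) (l' := w2)); auto.
        clear. induction w2; constructor; auto. apply rst_refl. }
      (* Deleting [w1] turns [u] into [y1], enabled after [p1] and labelled like [r]; [HK] yields a
         member of [l] that [y1] is not independent of, a contradiction. *)
      destruct (delete_prefix HX1 HX2 HR HRu Hp Hfu) as (y1 & y2 & Y1 & Y2 & HY).
      destruct (hp_sim_snoc HR HY) as (_ & Ly & Xy & _).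
      destruct (HK y1 Xy) as (_ & m & Hm & nI).
      { rewrite Ly, <- (simT_lab Y2), <- (simT_lab Sr). exact Kr. }
      apply nI. apply ForallOrdPairs_snoc_inv in Hfu; auto.
      assert (Sl : Forall2 (@simT L X1) w1 l).
      { clear - Sw. induction Sw; constructor; auto. apply rst_sym; auto. }
      pose proof (Forall_I_simT HX1 Y1 Sl Hfu) as Hy. rewrite Forall_forall in Hy. auto.
Qed.

End MultistepMatching.

Lemma inverse_run_ends (L : Type) (X1 X2 : TSI L) (R : list (trans X1) -> list (trans X2) -> Prop) :
  inverse (run_ends R) = run_ends (flip R).
Proof.
  do 4 (apply functional_extensionality; intros ?). apply propositional_extensionality.
  split; intros (p1 & p2 & H & A & B & C & D); exists p2, p1; auto 6.
Qed.

(** The relation [run_ends R] serves all formulas; only the relevant labels, and with them the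
    answering sets, vary with [phi]. *)
Theorem hhpb_TFL_eq (L : Type) (X1 X2 : TSI L) :
  is_TSI X1 -> is_TSI X2 -> hhpb X1 X2 -> TFL_eq X1 X2.
Proof.
  intros HX1 HX2 H phi. destruct (hhpb_hp_sim HX1 HX2 H) as (R & H0 & HR & HR').
  eapply (trace_sim_sat (K := fun a => In a (labels phi))).
  - apply (run_ends_trace_sim HX1 HX2 HR HR').
  - rewrite inverse_run_ends. apply (run_ends_trace_sim HX2 HX1 HR' HR).
  - auto.
  - exists [], []. auto.
Qed.

(** * The separating systems *)

Inductive letter : Type := la | lb | lc.
Inductive event : Type := ea | eb | eca | ecb | ecab.
(** States are configurations, named after the events executed so far. *)
Inductive config : Type := q0 | qa | qb | qab | qa_ca | qb_cb | qab_ca | qab_cb | qab_cab.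

(* The event executed by a transition; the flag [w] tells whether [ecab] exists. *)
Definition occurs (w : bool) (t : config * letter * config) : option event :=
  match t with
  | (q0, la, qa) | (qb, la, qab) | (qb_cb, la, qab_cb) => Some ea
  | (q0, lb, qb) | (qa, lb, qab) | (qa_ca, lb, qab_ca) => Some eb
  | (qa, lc, qa_ca) | (qab, lc, qab_ca) => Some eca
  | (qb, lc, qb_cb) | (qab, lc, qab_cb) => Some ecb
  | (qab, lc, qab_cab) => if w then Some ecab else None
  | _ => None
  end.

Definition concurrent (e f : event) : Prop :=
  match e, f with
  | ea, eb | eb, ea | ea, ecb | ecb, ea | eb, eca | eca, eb => True
  | _, _ => False
  end.

(** Independence is read off the events, so (A4) reduces to [simT] preserving events. *)
Definition cex (w : bool) : TSI letter := {|
  St := config;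
  s0 := q0;
  tr := fun s l s' => occurs w (s, l, s') <> None;
  ind := fun t u => match occurs w t, occurs w u with
                    | Some e, Some f => concurrent e f
                    | _, _ => False
                    end
|}.

Lemma cex_I (w : bool) (t u : trans (cex w)) :
  I t u <-> exists e f, occurs w t = Some e /\ occurs w u = Some f /\ concurrent e f.
Proof.
  unfold I. cbn. destruct (occurs w t) as [e|], (occurs w u) as [f|]; split; try easy.
  - intros H. exists e, f. auto.
  - intros (e' & f' & [= <-] & [= <-] & H). exact H.
  - intros (e' & f' & ? & ? & _). discriminate.
  - intros (e' & f' & ? & ? & _). discriminate.
  - intros (e' & f' & ? & ? & _). discriminate.
Qed.

Lemma cex_inT (w : bool) (t : trans (cex w)) : inT t <-> occurs w t <> None.
Proof. destruct t as [[s a] s']. reflexivity. Qed.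

Lemma occurs_det (w : bool) s a b s1 s2 e :
  occurs w (s, a, s1) = Some e -> occurs w (s, b, s2) = Some e -> s1 = s2.
Proof.
  destruct w, s, a, s1; try discriminate; destruct b, s2; cbn; congruence.
Qed.

(** The case [t = u] covers triples that are not transitions, on which the closure is still
    reflexive. *)
Lemma cex_simT (w : bool) (t u : trans (cex w)) :
  simT t u -> t = u \/ exists e, occurs w t = Some e /\ occurs w u = Some e.
Proof.
  induction 1 as [t u H| | |].
  - right. destruct H as (El & b & H1 & H2 & H3).
    apply cex_I in H1 as (e & f & E1 & E2 & _).
    apply cex_I in H3 as (e' & f' & E3 & E4 & Hc).
    assert (f = e') as -> by congruence. clear E3.
    apply cex_I in H2 as (e2 & f2 & _ & E5 & _).
    exists e. split; [exact E1|].
    destruct t as [[s a] s1], u as [[s2 a'] q]. cbn in *. subst a'.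
    destruct w, s, a, s1; try discriminate E1; destruct b, s2; try discriminate E2;
      destruct q; try discriminate E4; try discriminate E5; exact E1.
  - auto.
  - destruct IHclos_refl_sym_trans as [->|(e & ? & ?)]; eauto.
  - destruct IHclos_refl_sym_trans1 as [->|(e & ? & ?)]; auto.
    destruct IHclos_refl_sym_trans2 as [->|(e' & ? & ?)]; [eauto|].
    right. exists e. split; congruence.
Qed.

Lemma cex_is_TSI (w : bool) : is_TSI (cex w).
Proof.
  repeat split.
  - apply cex_I in H as (e & f & H & _). apply cex_inT. congruence.
  - apply cex_I in H as (e & f & _ & H & _). apply cex_inT. congruence.
  - intros t (e & f & He & Hf & H)%cex_I. rewrite He in Hf. injection Hf as <-. now destruct e.
  - intros t u (e & f & He & Hf & H)%cex_I. apply cex_I. exists f, e.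
    repeat split; auto. now destruct e, f.
  - intros s a s1 s2 [[= ->]|(e & H1 & H2)]%cex_simT; auto. eapply occurs_det; eassumption.
  - intros s a b s1 s2 H.
    (* It is enough to find the fourth corner of a square whose opposite sides carry the same
       event. *)
    cut (exists q, occurs w (s1, b, q) = occurs w (s, b, s2) /\
                   occurs w (s2, a, q) = occurs w (s, a, s1)).
    { intros (q & E1 & E2). exists q. apply cex_I in H as (e & f & He & Hf & H).
      split; apply cex_I; [exists e, f|exists f, e]; repeat split; try exact H; try exact He;
        try exact (eq_trans E1 Hf); try exact (eq_trans E2 He); try exact Hf.
      now destruct e, f. }
    apply cex_I in H as (e & f & He & Hf & H).
    destruct w, s, a, s1; try discriminate He; destruct b, s2; try discriminate Hf;
      injection He as <-; injection Hf as <-; try destruct H;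
      first [exists qab; split; reflexivity|exists qab_ca; split; reflexivity|exists qab_cb; split; reflexivity].
  - intros s a b s1 q H.
    cut (exists s2, occurs w (s, b, s2) = occurs w (s1, b, q) /\
                   occurs w (s2, a, q) = occurs w (s, a, s1)).
    { intros (s2 & E1 & E2). exists s2. apply cex_I in H as (e & f & He & Hf & H).
      split; apply cex_I; [exists e, f|exists f, e]; repeat split; try exact H; try exact He;
        try exact (eq_trans E1 Hf); try exact (eq_trans E2 He); try exact Hf.
      now destruct e, f. }
    apply cex_I in H as (e & f & He & Hf & H).
    destruct w, s, a, s1; try discriminate He; destruct b, q; try discriminate Hf;
      injection He as <-; injection Hf as <-; try destruct H;
      first [exists qa; split; reflexivity|exists qb; split; reflexivity
            |exists qa_ca; split; reflexivity|exists qb_cb; split; reflexivity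
            |exists qab; split; reflexivity].
  - intros I1. apply cex_simT in H as [<-|(e & E1 & E2)]; auto.
    apply cex_I in I1 as (e1 & f & He & Hf & Hc). apply cex_I. exists e, f.
    replace e1 with e in Hc by congruence. auto.
  - intros I1. apply cex_simT in H as [<-|(e & E1 & E2)]; auto.
    apply cex_I in I1 as (e1 & f & He & Hf & Hc). apply cex_I. exists e, f.
    replace e1 with e in Hc by congruence. auto.
  - intros s a. exists [q0; qa; qb; qab; qa_ca; qb_cb; qab_ca; qab_cb; qab_cab].
    intros s' _. destruct s'; cbn; tauto.
Qed.

(** No generating pair starts at [i], so a chain from [i] cannot leave it. *)
Lemma pord_fixed (L : Type) (X : TSI L) (p : list (trans X)) i j :
  (forall k ti tk, i < k -> nth_error p i = Some ti -> nth_error p k = Some tk -> I ti tk) ->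
  pord p i j -> j = i.
Proof.
  intros H Hp. unfold pord in Hp. apply clos_rt_rtn1 in Hp.
  induction Hp as [|j k (Hj & _ & tj & tk & Ej & Ek & HI)]; [reflexivity|].
  subst j. destruct HI. eauto.
Qed.

(** Adam plays [ea], [eb] and then [ecab], whose position lies above both others; [eca] lies only
    above [ea], and [ecb] only above [eb]. *)
Lemma cex_not_hhpb : ~ hhpb (cex true) (cex false).
Proof.
  intros (Rel & H0 & H).
  pose proof (H _ _ H0) as (F & _).
  destruct (F (q0, la, qa)) as ([[x1 l1] y1] & T1 & S1 & L1 & _ & H1);
    [discriminate|reflexivity|]. cbn in L1, S1. subst x1 l1.
  destruct y1; try (destruct T1; reflexivity). clear T1 F.
  pose proof (H _ _ H1) as (F & _).
  destruct (F (qa, lb, qab)) as ([[x2 l2] y2] & T2 & S2 & L2 & _ & H2);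
    [discriminate|reflexivity|]. cbn in L2, S2. subst x2 l2.
  destruct y2; try (destruct T2; reflexivity). clear T2 F.
  pose proof (H _ _ H2) as (F & _).
  destruct (F (qab, lc, qab_cab)) as (v & T3 & S3 & L3 & [_ Hiso] & _);
    [discriminate|reflexivity|]. cbn in Hiso.
  destruct Hiso as (_ & f & _ & _ & Hlab & Hord). cbn in Hlab, Hord.
  destruct v as [[x3 l3] y3]. cbn in L3, S3. subst x3 l3.
  (* The three labels are distinct, which forces the isomorphism to be the identity. *)
  assert (Hf : f 0 = 0 /\ f 1 = 1 /\ f 2 = 2).
  { destruct (Hlab 0 _ eq_refl) as (t0 & E0 & L0).
    destruct (Hlab 1 _ eq_refl) as (t1 & E1 & L1).
    destruct (Hlab 2 _ eq_refl) as (t2 & E2 & L2). clear - E0 L0 E1 L1 E2 L2.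
    destruct (f 0) as [|[|[|[|]]]]; try discriminate E0; injection E0 as <-; try discriminate L0;
    destruct (f 1) as [|[|[|[|]]]]; try discriminate E1; injection E1 as <-; try discriminate L1;
    destruct (f 2) as [|[|[|[|]]]]; try discriminate E2; injection E2 as <-; try discriminate L2;
    auto. }
  destruct Hf as (F0 & F1 & F2).
  assert (O02 : pord (X:=cex false) [(q0, la, qa); (qa, lb, qab); (qab, lc, y3)] 0 2).
  { rewrite <- F0 at 1. rewrite <- F2. apply Hord; auto. apply rt_step.
    split; [lia|]. split; [cbn; lia|]. do 2 eexists. split; [reflexivity|]. split; [reflexivity|]. easy. }
  assert (O12 : pord (X:=cex false) [(q0, la, qa); (qa, lb, qab); (qab, lc, y3)] 1 2).
  { rewrite <- F1 at 1. rewrite <- F2. apply Hord; auto. apply rt_step.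
    split; [lia|]. split; [cbn; lia|]. do 2 eexists. split; [reflexivity|]. split; [reflexivity|]. easy. }
  (* Answering with [eca] contradicts the dependence on [eb] at position 1, answering with [ecb]
     that on [ea] at position 0. *)
  destruct y3; try (destruct T3; reflexivity).
  - apply pord_fixed in O12; [discriminate|].
    intros [|[|[|[|k]]]] ti tk Hk [= <-] Ek; try lia; try discriminate.
    injection Ek as <-. easy.
  - apply pord_fixed in O02; [discriminate|].
    intros [|[|[|[|k]]]] ti tk Hk [= <-] Ek; try lia; try discriminate.
    all: injection Ek as <-; easy.
Qed.

(** * TFL-equivalence of the two systems *)

Definition dead (s : config) : Prop := s = qab_ca \/ s = qab_cb \/ s = qab_cab.

(** The systems differ only in a transition leaving [qab], so processes coincide until [qab] is
    left, and then both are terminal. The extra clause records that the last transition did not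
    start in [qab] and that [qab] is entered by [ea] or [eb]. *)
Definition cex_rel (w w' : bool) : state_rel (cex w) (cex w') :=
  fun (s : config) (t : option (config * letter * config)) (s' : config) (t' : option (config * letter * config)) =>
    (dead s /\ dead s') \/
    (s = s' /\ t = t' /\
     match t with
     | None => s <> qab
     | Some t0 => fst (fst t0) <> qab /\
                  (s = qab -> t0 = (qa, lb, qab) \/ t0 = (qb, la, qab))
     end).

Lemma cex_rel_inverse (w w' : bool) : inverse (@cex_rel w w') = @cex_rel w' w.
Proof.
  do 4 (apply functional_extensionality; intros ?). apply propositional_extensionality.
  unfold inverse, cex_rel. split; (intros [[A B]|(<- & <- & C)]; [left|right]; auto).
Qed.

Lemma occurs_indep (w w' : bool) (t : config * letter * config) :
  fst (fst t) <> qab -> occurs w t = occurs w' t.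
Proof. now destruct t as [[[] []] []]. Qed.

Lemma cex_Xs_indep (w w' : bool) (s : config) (t : config * letter * config) :
  s <> qab -> Xs (X:=cex w) s t -> Xs (X:=cex w') s t.
Proof.
  intros Hs [Ht <-]. split; [|reflexivity]. apply (cex_inT (w:=w) t) in Ht. apply (cex_inT (w:=w') t).
  rewrite <- (occurs_indep w w' Hs). exact Ht.
Qed.

Lemma cex_I_indep (w w' : bool) (t u : config * letter * config) :
  fst (fst t) <> qab -> fst (fst u) <> qab -> I (X:=cex w) t u -> I (X:=cex w') t u.
Proof.
  intros Ht Hu. rewrite !cex_I, (occurs_indep w w' Ht), (occurs_indep w w' Hu). auto.
Qed.

Lemma cex_max_cf_indep (w w' : bool) (s : config) (M : config * letter * config -> Prop) :
  s <> qab -> max_cf (X:=cex w) s M -> max_cf (X:=cex w') s M.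
Proof.
  intros Hs (Hne & (_ & _ & Hcf) & Hsub & Hmax).
  assert (Hsrc : forall t, M t -> fst (fst t) <> qab).
  { intros t Mt. destruct (Hsub _ Mt) as [_ E]. intros E'. apply Hs. rewrite <- E. exact E'. }
  assert (Hsub' : forall t, M t -> Xs (X:=cex w') s t).
  { intros t Mt. apply (cex_Xs_indep (w:=w)), Hsub; auto. }
  split; [exact Hne|]. split; [|split; [exact Hsub'|]].
  - split; [intros t Mt; apply (Hsub' t Mt)|].
    split; [exists s; intros t Mt; apply (Hsub' t Mt)|].
    intros t u Mt Mu Hn. destruct (Hcf t u Mt Mu Hn) as [E HI].
    split; [exact E|]. apply (cex_I_indep (w:=w)); auto.
  - intros (t & Xt & nMt & Ht). apply Hmax. exists t.
    split; [apply (cex_Xs_indep (w:=w')); auto|]. split; [exact nMt|].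
    intros u Mu. destruct (Ht u Mu) as [E HI]. split; [exact E|].
    apply (cex_I_indep (w:=w')); auto.
    intros E'. apply Hs. rewrite <- (proj2 Xt). exact E'.
Qed.

Lemma dead_Xs (w : bool) s (t : trans (cex w)) : dead s -> ~ Xs (X:=cex w) s t.
Proof.
  intros Hs [Ht E]. apply (cex_inT (w:=w) t) in Ht. destruct t as [[s' a] q]. cbn in E. subst s'.
  destruct Hs as [->|[->| ->]]; destruct a, q; apply Ht; reflexivity.
Qed.

(** Only [eca], [ecb] and, if present, [ecab] are enabled at [qab], no two of them concurrent; hence
    the maximal conflict-free sets there are the singletons. *)
Lemma qab_conflict (w : bool) (t u : trans (cex w)) :
  Xs (X:=cex w) qab t -> Xs (X:=cex w) qab u -> ~ I t u.
Proof.
  intros [_ Et] [_ Eu] (e & f & He & Hf & H)%cex_I.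
  destruct t as [[s a] q], u as [[s' b] q']. cbn in Et, Eu. subst s s'.
  destruct w, a, q; try discriminate He; injection He as <-;
    destruct b, q'; try discriminate Hf; injection Hf as <-; exact H.
Qed.

Lemma qab_max_cf (w : bool) (t : trans (cex w)) :
  Xs (X:=cex w) qab t -> max_cf (X:=cex w) qab (eq t).
Proof.
  intros Ht. split; [eauto|]. split; [split; [|split]|split].
  - intros u <-. apply Ht.
  - exists qab. intros u <-. apply Ht.
  - intros u v <- <-. contradiction.
  - intros u <-. exact Ht.
  - intros (u & Hu & _ & H). apply (qab_conflict Hu Ht), H. reflexivity.
Qed.

Lemma qab_max_cf_inv (w : bool) (M : tset (cex w)) t u :
  max_cf (X:=cex w) qab M -> M t -> M u -> t = u.
Proof.
  intros HM Mt Mu. apply NNPP. intros Hn.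
  apply (qab_conflict (max_cf_in_Xs HM Mt) (max_cf_in_Xs HM Mu)).
  destruct HM as (_ & (_ & _ & Hcf) & _). apply Hcf; auto.
Qed.

(* The event [ecab] depends on both [ea] and [eb]; seen from a last transition
   [eb] it is mimicked by [ecb], seen from a last transition [ea] by [eca]. *)
Lemma qab_matching (w w' : bool) t0 (r : trans (cex w)) :
  t0 = (qa, lb, qab) \/ t0 = (qb, la, qab) -> Xs (X:=cex w) qab r ->
  exists r' : trans (cex w'), Xs (X:=cex w') qab r' /\
    matching (@cex_rel w w') (Some t0) (Some t0) r r'.
Proof.
  intros Ht0 [Hr E]. apply (cex_inT (w:=w) r) in Hr. destruct r as [[s a] q]. cbn in E. subst s.
  destruct Ht0 as [->| ->]; destruct a, q; try (destruct Hr; reflexivity);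
  first [ exists (qab, lc, qab_ca); split; [split; [discriminate|reflexivity]|];
          unfold matching, leA, ominusA, leT, ominus, cex_rel, dead, I; cbn; destruct w; cbn; tauto
        | exists (qab, lc, qab_cb); split; [split; [discriminate|reflexivity]|];
          unfold matching, leA, ominusA, leT, ominus, cex_rel, dead, I; cbn; destruct w; cbn; tauto ].
Qed.

Lemma non_qab_matching (w w' : bool) s t0 (r : config * letter * config) :
  s <> qab -> match t0 with Some t => fst (fst t) <> qab | None => True end ->
  Xs (X:=cex w) s r -> matching (@cex_rel w w') t0 t0 r r.
Proof.
  intros Hs Ht0 [Hr Er]. apply (cex_inT (w:=w) r) in Hr.
  assert (Hr' : fst (fst r) <> qab) by (intros E; apply Hs; rewrite <- Er; exact E).
  split; [reflexivity|]. split; [|split].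
  - destruct t0 as [t|]; [|cbn; tauto]. unfold leA, leT.
    split; intros [A B]; (split; [exact A|]; intros HI; apply B).
    + apply (cex_I_indep (w:=w')); auto.
    + apply (cex_I_indep (w:=w)); auto.
  - destruct t0 as [t|]; [|cbn; tauto]. unfold ominusA, ominus.
    split; intros [A B]; (split; [exact A|]).
    + apply (cex_I_indep (w:=w)); auto.
    + apply (cex_I_indep (w:=w')); auto.
  - right. split; [reflexivity|]. split; [reflexivity|]. split; [exact Hr'|].
    (* Only [ea] from [qb] and [eb] from [qa] lead into [qab]. *)
    destruct r as [[x a] y]. cbn in *. intros ->. clear - Hr.
    destruct x, a; try (destruct Hr; reflexivity); auto.
Qed.

Lemma cex_trace_sim (w w' : bool) K : trace_sim K (@cex_rel w w').
Proof.
  intros s t s' t' [[D D']|(<- & <- & Ht)].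
  - split; [split; intros r Hr; exfalso; [exact (dead_Xs D Hr)|exact (dead_Xs D' Hr)]|].
    intros M HM. exfalso. destruct HM as ([m Mm] & _ & HM & _).
    exact (dead_Xs D (HM m Mm)).
  - destruct (classic (s = qab)) as [->|Hs].
    + destruct t as [t0|]; [|congruence]. destruct Ht as [_ Ht0]. specialize (Ht0 eq_refl).
      split; [split; intros r Hr _|].
      * apply qab_matching; auto.
      * destruct (qab_matching (w:=w') w Ht0 Hr) as (r' & Hr' & A & B & C & D).
        exists r'. split; [exact Hr'|]. split; [auto|]. split; [tauto|]. split; [tauto|].
        rewrite <- cex_rel_inverse in D. exact D.
      (* At [qab] the set [M] is a singleton, answered by the singleton of the matching
         transition. *)
      * intros M HM. destruct (proj1 HM) as [r Mr].
        destruct (qab_matching (w:=w) w' Ht0 (max_cf_in_Xs HM Mr)) as (r' & Hr' & Hm).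
        exists (eq r'). split; [apply qab_max_cf, Hr'|]. split.
        -- intros x Mx _. rewrite (qab_max_cf_inv HM Mx Mr). eauto.
        -- intros x <- _. eauto.
    + assert (Hsrc : match t with Some t0 => fst (fst t0) <> qab | None => True end)
        by (destruct t; [apply Ht|exact Logic.I]).
      split; [split; intros r Hr _; exists r|].
      * split; [apply (cex_Xs_indep (w:=w)); auto|]. apply (@non_qab_matching w w' s); auto.
      * pose proof (cex_Xs_indep (w:=w') w Hs Hr) as Hr'.
        split; [exact Hr'|apply (@non_qab_matching w w' s); auto].
      * intros M HM. exists M. split; [apply (cex_max_cf_indep (w:=w)); auto|].
        pose proof (fun x => @max_cf_in_Xs _ (cex w) s M x HM) as Hx.
        split; intros x Mx _; exists x; (split; [exact Mx|]);
          apply (@non_qab_matching w w' s); auto.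
Qed.

Lemma cex_TFL_eq : TFL_eq (cex true) (cex false).
Proof.
  intros phi. apply (trace_sim_sat (K := fun _ => True) (Q := @cex_rel true false)); auto.
  - apply cex_trace_sim.
  - rewrite cex_rel_inverse. apply cex_trace_sim.
  - right. split; [reflexivity|]. split; [reflexivity|discriminate].
Qed.

Theorem theorem5 :
  (forall (L : Type) (X1 X2 : TSI L),
      is_TSI X1 -> is_TSI X2 -> hhpb X1 X2 -> TFL_eq X1 X2) /\
  (exists (L : Type) (X1 X2 : TSI L),
      is_TSI X1 /\ is_TSI X2 /\ TFL_eq X1 X2 /\ ~ hhpb X1 X2).
Proof.
  split; [exact hhpb_TFL_eq|].
  exists letter, (cex true), (cex false).
  exact (conj (cex_is_TSI true) (conj (cex_is_TSI false) (conj cex_TFL_eq cex_not_hhpb))).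
Qed.
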